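(* Let $(X,f)$ be a topological dynamical system satisfying the non-uniform specification property (with some gap function). Then: (1) for every non-empty over-saturated set $G^K$ one has $h_{top}^P(f,G^K)=h_{top}(f)$; (2) $h_{top}^P\big(f,\mathrm{CI}(f)\big)=h_{top}(f)$.
   Context: A topological dynamical system $(X,f)$ consists of a compact metric space $(X,d)$ with at least two points and a continuous map $f:X\to X$. $C(X)$ is the space of real continuous functions on $X$; $\mathcal{M}_f(X)$ is the set of $f$-invariant Borel probability measures with the weak$^*$ topology; $h_{top}(f)$ is topological entropy. Non-uniform specification: $(X,f)$ has the non-uniform specification property with gap function $M:\mathbb{N}\times(0,\infty)\to\mathbb{N}$ ($\mathbb{N}$ the positive integers) if $M(n,\varepsilon)$ is non-decreasing in $n$ and non-increasing in $\varepsilon$, and for every $\varepsilon>0$, every integer $k\ge2$, all $x_1,\dots,x_k\in X$ and all non-negative integers $a_1\le b_1<a_2\le b_2<\cdots<a_k\le b_k$ with $a_{i+1}-b_i\ge M(b_i-a_i+1,\varepsilon)$ for $1\le i\le k-1$, there is $z\in X$ with $d(f^{n-a_i}x_i,f^nz)\le\varepsilon$ for all $a_i\le n\le b_i$, $1\le i\le k$. Over-saturated sets: $V_f(x)$ is the set of weak$^*$ accumulation points of $\delta_x^n=\frac1n\sum_{k=0}^{n-1}\delta_{f^kx}$ ($n\ge1$), and for $K\subset\mathcal{M}_f(X)$, $G^K=\{x\in X:V_f(x)\supset K\}$. Completely-irregular set: for $\varphi\in C(X)$, $I_\varphi(f)=\{x\in X:\lim_{n\to\infty}\frac1n\sum_{k=0}^{n-1}\varphi(f^kx)\text{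 does not exist}\}$; $\mathfrak{C}(f)=\{\varphi\in C(X):I_\varphi(f)\ne\varnothing\}$; $\mathrm{CI}(f)=\bigcap_{\varphi\in\mathfrak{C}(f)}I_\varphi(f)$. Packing topological entropy of $E\subset X$: let $B_n(x,\varepsilon)=\{y:\max_{0\le i\le n-1}d(f^ix,f^iy)<\varepsilon\}$. For $t\ge0$ let $Q(E;t,N,\varepsilon,f)$ be the supremum of $\sum_ke^{-tn_k}$ over finite or countable pairwise disjoint families $\{\overline{B_{n_k}(x_k,\varepsilon)}\}$ with $x_k\in E$, $n_k\ge N$; let $Q(E;t,\varepsilon,f)=\lim_{N\to\infty}Q(E;t,N,\varepsilon,f)$, $P(E;t,\varepsilon,f)=\inf\{\sum_{j=1}^\infty Q(E_j;t,\varepsilon,f):\bigcup_{j=1}^\infty E_j\supset E\}$, $h_{top}^P(E;\varepsilon,f)=\inf\{t\ge0:P(E;t,\varepsilon,f)=0\}$ and $h_{top}^P(f,E)=\lim_{\varepsilon\to0}h_{top}^P(E;\varepsilon,f)$. *)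

(* Defs.v *)
From HB Require Import structures.
From mathcomp Require Import all_boot all_order all_algebra finmap.
From mathcomp Require Import all_classical all_reals all_analysis.

Set Implicit Arguments.
Unset Strict Implicit.
Unset Printing Implicit Defensive.
Import Order.TTheory GRing.Theory Num.Theory.
Import numFieldNormedType.Exports.

Local Open Scope classical_set_scope.
Local Open Scope ring_scope.

(* Measurable types carry a base point, so the Borel
   sigma-algebra below needs one; on a nonempty space this is no restriction,
   and the base point plays no other role. *)
#[short(type="pointedMetricType")]
HB.structure Definition PointedMetric (R : numDomainType) :=
  {X of Metric R X & Pointed X}.

Section dynamics.
Context {R : realType} {X : pointedMetricType R}.
Implicit Types (f : X -> X) (x : X) (n N : nat) (eps t : R) (E : set X).

Definition bowen_dist f n x y : R :=
  \big[Num.max/0]_(i < n) mdist (iter i f x) (iter i f y).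

Definition bowen_ball f n x eps : set X := [set y | bowen_dist f n x y < eps].

Definition separated_set f n eps (A : {fset X}) : Prop :=
  forall x y, x \in A -> y \in A -> x != y -> eps < bowen_dist f n x y.

Definition separated_number f n eps : \bar R :=
  ereal_sup [set (#|` A|%:R)%:E | A in [set A : {fset X} | separated_set f n eps A]].

(* Bowen's definition by (n, eps)-separated sets; the outer limit is monotone
   in eps and exists in \bar R. *)
Definition htop_scale f eps : \bar R :=
  limn_esup (fun n => ((n%:R^-1)%:E * lne (separated_number f n eps))%E).

Definition htop f : \bar R := lim (htop_scale f eps @[eps --> 0^'+]).

(* A finite or countable family is indexed by an arbitrary I : set nat. Each
   closed ball contains its centre (eps > 0), so disjointness of the indexed
   family also prevents repetitions. *)
Definition packing_admissible f E N eps (I : set nat) (x : nat -> X)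
    (n : nat -> nat) : Prop :=
  (forall k, I k -> E (x k) /\ (N <= n k)%N) /\
  trivIset I (fun k => closure (bowen_ball f (n k) (x k) eps)).

Definition packing_QN f E t N eps : \bar R :=
  ereal_sup [set s | exists (I : set nat) (x : nat -> X) (n : nat -> nat),
    packing_admissible f E N eps I x n /\
    s = \esum_(k in I) (expR (- (t * (n k)%:R)))%:E].

Definition packing_Q f E t eps : \bar R := limn (packing_QN f E t ^~ eps).

Definition packing_P f E t eps : \bar R :=
  ereal_inf [set (\sum_(0 <= j <oo) packing_Q f (F j) t eps)%E |
              F in [set F : nat -> set X | E `<=` \bigcup_j F j]].

Definition packing_entropy_scale f E eps : \bar R :=
  ereal_inf [set t%:E | t in [set t | 0 <= t /\ packing_P f E t eps = 0%E]].

Definition packing_entropy f E : \bar R :=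
  lim (packing_entropy_scale f E eps @[eps --> 0^'+]).

(* Only the values M n eps with n > 0 and eps > 0 are relevant. *)
Definition gap_function (M : nat -> R -> nat) : Prop :=
  [/\ forall n eps, (0 < n)%N -> 0 < eps -> (0 < M n eps)%N,
      forall m n eps, (0 < m <= n)%N -> 0 < eps -> (M m eps <= M n eps)%N &
      forall n eps1 eps2, (0 < n)%N -> 0 < eps1 -> eps1 <= eps2 ->
        (M n eps2 <= M n eps1)%N].

(* The orbit segments are numbered from 0 to k - 1; values of x, a, b at
   indices i >= k are irrelevant. *)
Definition nonuniform_specification f (M : nat -> R -> nat) : Prop :=
  gap_function M /\
  forall eps, 0 < eps -> forall k, (2 <= k)%N ->
  forall (x : nat -> X) (a b : nat -> nat),
    (forall i, (i < k)%N -> (a i <= b i)%N) ->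
    (forall i, (i.+1 < k)%N ->
       (b i < a i.+1)%N /\ (M (b i - a i + 1)%N eps <= a i.+1 - b i)%N) ->
    exists z, forall i, (i < k)%N -> forall n, (a i <= n <= b i)%N ->
      mdist (iter (n - a i) f (x i)) (iter n f z) <= eps.

Definition borel : measurableType _ := g_sigma_algebraType (@open X).

(* A [probability] is also defined on non-measurable sets; neither invariance
   nor the weak-* topology below depends on its values there. *)
Definition invariant_measures f : set (probability borel R) :=
  [set mu | forall A : set borel, measurable A -> mu (f @^-1` A) = mu A].

(* The coarsest topology making every mu |-> \int phi d mu continuous, for phi
   a continuous real function. *)
Definition weak_star : topologicalType :=
  initial_topology (fun mu : probability borel R =>
    (fun phi : continuousType X R => \int[mu]_x phi x)
      : {ptws (continuousType X R) -> R}).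

(* (1 / (n+1)) * sum_{k < n+1} delta_{f^k x}: the index is shifted by one so
   that every term is a probability measure. *)
Definition empirical f x n : set borel -> \bar R :=
  mscale ((n.+1%:R^-1 : R)%:nng) (msum (fun k => \d_(iter k f x : borel)) n.+1).

HB.instance Definition _ f x n := Measure.on (@empirical f x n).

Lemma empirical_setT f x n : empirical f x n [set: borel] = 1%E.
Proof.
rewrite /empirical /mscale /= /msum; rewrite (eq_bigr (fun=> 1%E)); last by move=> k _; exact: diracT.
rewrite sumEFin -EFinM sumr_const card_ord mulVf// pnatr_eq0.
Qed.

HB.instance Definition _ f x n :=
  Measure_isProbability.Build _ _ _ (@empirical f x n) (empirical_setT f x n).

Definition limit_measures f x : set (probability borel R) :=
  cluster ((fun n => empirical f x n : weak_star) @ \oo).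

Definition oversaturated f (K : set (probability borel R)) : set X :=
  [set x | K `<=` limit_measures f x].

Definition birkhoff_average f (phi : X -> R) x n : R :=
  n%:R^-1 * \sum_(k < n) phi (iter k f x).

Definition irregular_set f (phi : X -> R) : set X :=
  [set x | ~ cvgn (birkhoff_average f phi x)].

(* If no continuous function has irregular points, this is the whole space. *)
Definition completely_irregular f : set X :=
  \bigcap_(phi in [set phi : X -> R |
                    continuous phi /\ irregular_set f phi !=set0])
    irregular_set f phi.

End dynamics.

Arguments borel {R} X.

(* Main.v *)
Require Import Defs.
From mathcomp Require Import all_boot all_order all_algebra finmap.
From mathcomp Require Import all_classical all_reals all_analysis.
From mathcomp Require Import measurable_realfun ring lra.
Set Implicit Arguments.
Unset Strict Implicit.
Unset Printing Implicit Defensive.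
Import Order.TTheory GRing.Theory Num.Theory.
Import numFieldNormedType.Exports.
Local Open Scope classical_set_scope.
Local Open Scope ring_scope.

(* With two orbit segments, the first of length 1, non-uniform specification
   says: for every nonempty open U and e > 0 there is a delay a such that every
   orbit segment, of any length L, is e-shadowed from time a on by a point of U.
   As a does not depend on L, two things follow.

   - For a point y and an infinite set S of times, the z whose orbit imitates y
     over L steps after a delay a << L, for infinitely many L in S, form a dense
     G_delta set.  Countably many pairs (y, S) suffice to make each limit point
     of the Birkhoff averages (of any finite family of continuous functions) of
     any x a limit point of those of z.  Such "universal" z belong to
     every nonempty G^K and to CI(f).

   - A residual set Z has full packing entropy: if Z is covered by sets F_j, then
     by Baire some F_j is dense in a nonempty open U, and shadowing separated
     sets of length L from U gives exponentially many disjoint Bowen balls of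
     order a + L centred in F_j. *)

(** * Baire category in compact Hausdorff spaces *)

Lemma compact_hausdorff_baire (T : topologicalType) (O : nat -> set T) :
  compact [set: T] -> hausdorff_space T ->
  (forall i, open (O i) /\ dense (O i)) -> dense (\bigcap_i O i).
Proof.
move=> cT hT Oi D D0 oD.
have shrink (U V : set T) : open U -> U !=set0 -> open V -> dense V ->
    exists W, [/\ open W, W !=set0 & closure W `<=` U `&` V].
  move=> oU U0 oV dV; have [x UVx] := dV U U0 oU.
  have nx : nbhs x (U `&` V) by apply: open_nbhs_nbhs; split=> //; exact: openI.
  have [W Wx WUV] : filter_from (nbhs x) closure (U `&` V).
    by apply: (compact_regular hT cT filterT).
  exists W°; split; first exact: open_interior.
    by exists x.
  by apply: subset_trans WUV; apply: closure_subset; exact: interior_subset.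
pose S := {U : set T | open U /\ U !=set0}.
(* The stage number travels with the open set, so that dependent choice knows which [O n] to enter
   next. *)
pose rel (p q : nat * S) := q.1 = p.1.+1 /\
  closure (sval q.2) `<=` sval p.2 `&` O p.1.
have step p : {q | rel p q}.
  apply: cid; case: p => n [U [oU U0]].
  have [W [oW W0 WUO]] := shrink U (O n) oU U0 (Oi n).1 (Oi n).2.
  by exists (n.+1, exist _ W (conj oW W0)).
have [u [u0 uS]] := dependent_choice step (0%N, exist _ D (conj oD D0)).
pose U k := sval (u k).2.
have un k : (u k).1 = k.
  by elim: k => [|k ih]; [rewrite u0|rewrite (uS k).1 ih].
have US k : closure (U k.+1) `<=` U k `&` O k.
  by have := (uS k).2; rewrite un.
have Udec k m : (k <= m)%N -> U m `<=` U k.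
  elim: m => [|m ih]; first by rewrite leqn0 => /eqP ->.
  rewrite leq_eqVlt => /predU1P[-> //|/ih]; apply: subset_trans.
  by move=> x /subset_closure /US[].
have Un0 k : {x | U k x} by apply: cid; exact: (svalP (u k).2).2.
(* Points picked in the sets [U k] cluster by compactness; since these sets decrease, the cluster
   point lies in every [closure (U k)]. *)
have [x [_ clx]] := cT _ (fmap_proper_filter (fun k => sval (Un0 k)) eventually_filter) filterT.
have Ux k : closure (U k) x.
  move=> B Bx; apply: clx => //; exists k => // m /= km.
  exact: (Udec _ _ km) (svalP (Un0 m)).
exists x; split; last by move=> i _; exact: (US i x (Ux i.+1)).2.
by have [+ _] := US 0%N x (Ux 1%N); rewrite /U u0.
Qed.

(** * Uniform continuity and countable approximation on a compact metric space *)

Section compact_metric.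
Context {R : realType} {X : pointedMetricType R}.
Hypothesis compactX : compact [set: X].

Lemma uniform_modulus (phi : X -> R) (w : R) : continuous phi -> 0 < w ->
  exists2 e, 0 < e & forall x y, mdist x y < e -> `|phi x - phi y| < w.
Proof.
move=> cphi w0; pose P (e : R) x := forall y, mdist x y < e -> `|phi x - phi y| < w.
have /compact_near_coveringP/(_ _ (0^'+) P) := compactX.
case=> [x _|e /= e0 eP].
- have w20 : 0 < w / 2 by rewrite divr_gt0.
  have /cvgrPdist_lt/(_ _ w20)/nbhs_ballP[r /= r0 rP] := cphi x.
  (* Half radii: [x'] is within [r / 2] of [x] and [y] within [r / 2] of [x'], so both lie in the
     ball of radius [r] around [x]. *)
  exists (ball x (r / 2), [set e | 0 < e <= r / 2]) => /=.
    split; first by apply: nbhsx_ballx; rewrite divr_gt0.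
    near=> e; apply/andP; split; first by near: e; exact: nbhs_right_gt.
    by near: e; apply: nbhs_right_le; rewrite divr_gt0.
  move=> [x' e] /= [xx' /andP[e0 er]] y x'y.
  have xy : ball x r y.
    rewrite [r]splitr; apply: ball_triangle xx' _; rewrite ballEmdist/=.
    exact: lt_le_trans x'y er.
  have {}xx' : ball x r x' by apply: le_ball xx'; rewrite ler_pdivrMr//; lra.
  have := rP _ xx'; have := rP _ xy; rewrite /= => h1 h2.
  have -> : phi x' - phi y = (phi x - phi y) - (phi x - phi x') by ring.
  by rewrite (le_lt_trans (ler_normB _ _))// [w]splitr ltrD.
- exists (e / 2); first by rewrite divr_gt0.
  move=> x y; apply: (eP (e / 2)) => //; last by rewrite divr_gt0.
  by rewrite /ball/= sub0r normrN gtr0_norm ?divr_gt0// ltr_pdivrMr//; lra.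
Unshelve. all: by end_near. Qed.

Lemma compact_fun_bounded (phi : X -> R) : continuous phi ->
  exists2 C, 0 <= C & forall x, `|phi x| <= C.
Proof.
move=> cphi.
have /compact_bounded : compact (phi @` setT).
  by apply: continuous_compact => //; exact: continuous_subspaceT.
move=> /pinfty_ex_gt0[C C0 CP]; exists C; first exact: ltW.
by move=> x; apply: CP; exists x.
Qed.

(* The approximants need not be continuous: step functions on the cells of
   finite partitions of small mesh suffice. *)
Lemma countable_uniform_approx : exists F : nat -> X -> R,
  forall phi : X -> R, continuous phi -> forall w, 0 < w ->
  exists m, forall x, `|phi x - F m x| < w.
Proof.
have net e : 0 < e -> exists s : seq X, forall x, exists2 y, y \in s & ball y e x.
  move=> e0.
  have [s _ sP] : finite_subset_cover setT (fun y => (ball y e)°) [set: X].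
    have := compactX; rewrite compact_cover; apply.
      by move=> y _; exact: open_interior.
    by move=> x _; exists x => //; exact: nbhsx_ballx.
  exists s => x; have [y ys xy] := sP x I.
  by exists y => //; exact: interior_subset xy.
have {net} /choice[s sP] : forall j : nat, exists s : seq X,
    forall x, exists2 y, y \in s & ball y (j.+1%:R^-1) x.
  by move=> j; apply: net.
(* Cells are cut out by the first net point of [s j] within [1 / (j + 1)]; [F] decodes [m] into a
   mesh index and one rational value per cell. *)
pose cell j x := find (fun y => `[< ball y j.+1%:R^-1 x >]) (s j).
pose F m x : R := if (choice.unpickle m : option (nat * seq rat)) is Some (j, q)
  then ratr (nth 0 q (cell j x)) else 0.
exists F => phi cphi w w0.
have w20 : 0 < w / 2 by rewrite divr_gt0.
have [e e0 eP] := uniform_modulus cphi w20.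
have [j _ /(_ j (leqnn j)) /= je] := near_infty_natSinv_lt (PosNum e0).
have /choice[q qP] : forall y, exists q : rat, `|phi y - ratr q| < w / 2.
  move=> y; have [|q] := @rat_in_itvoo _ (phi y - w / 2) (phi y + w / 2); first by lra.
  rewrite in_itv/= => /andP[h1 h2]; exists q; rewrite ltr_norml; lra.
exists (choice.pickle (j, map q (s j))) => x; rewrite /F choice.pickleK.
have [y ys xy] := sP j x.
have hasc : has (fun y => `[< ball y j.+1%:R^-1 x >]) (s j).
  by apply/hasP; exists y => //; exact/asboolP.
have lt : (cell j x < size (s j))%N by rewrite /cell -has_find.
rewrite (nth_map point)//.
set c := nth point _ _.
have : ball c j.+1%:R^-1 x by apply/asboolP; exact: nth_find hasc.
rewrite ballEmdist/= => cx.
have := eP c x (lt_trans cx je); have := qP c.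
have -> : phi x - ratr (q c) = (phi c - ratr (q c)) - (phi c - phi x) by ring.
by move=> h1 h2; rewrite (le_lt_trans (ler_normB _ _))// [w]splitr ltrD.
Qed.

Lemma continuous_family_control (Phi : nat -> X -> R) (k : nat) (w : R) :
  (forall i, (i < k)%N -> continuous (Phi i)) -> 0 < w ->
  exists C e : R, [/\ 0 <= C, 0 < e,
    forall i x, (i < k)%N -> `|Phi i x| <= C &
    forall i x y, (i < k)%N -> mdist x y < e -> `|Phi i x - Phi i y| < w].
Proof.
elim: k => [|k ih] cPhi w0; first by exists 0, 1; split.
have [|C [e [C0 e0 h1 h2]]] := ih _ w0; first by move=> i /ltnW; exact: cPhi.
have cPhik : continuous (Phi k) by exact: cPhi.
have [C' C'0 C'P] := compact_fun_bounded cPhik.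
have [e' e'0 e'P] := uniform_modulus cPhik w0.
exists (Num.max C C'), (Num.min e e'); split.
- by rewrite le_max C0.
- by rewrite lt_min e0.
- move=> i x; rewrite ltnS leq_eqVlt le_max.
  by move=> /predU1P[->|/h1->//]; rewrite C'P orbT.
- move=> i x y; rewrite ltnS leq_eqVlt lt_min => /predU1P[->|ik] /andP[xy xy'].
    exact: e'P.
  exact: h2.
Qed.

End compact_metric.

(** * Shadowing of orbit segments and its effect on Birkhoff averages *)

Section shadowing.
Context {R : realType} {X : pointedMetricType R}.
Variable f : X -> X.

(** The strict inequality makes the condition open in [z]. *)
Definition shadows (e : R) (a L : nat) (y z : X) : Prop :=
  forall k, (k < L)%N -> mdist (iter k f y) (iter (a + k) f z) < e.

Lemma open_mdist_lt (c : X) (e : R) : open [set z : X | mdist c z < e].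
Proof.
rewrite openE => z /= cz; apply/nbhs_ballP.
exists (e - mdist c z); first by rewrite /= subr_gt0.
move=> y; rewrite ballEmdist/= => zy.
by rewrite (le_lt_trans (metric_triangle _ z _))//; lra.
Qed.

Hypothesis cf : continuous f.

Lemma continuous_iter k : continuous (iter k f).
Proof.
elim: k => [|k ih] x; first exact: cvg_id.
by apply: (@continuous_comp _ _ _ (iter k f) f x (ih x)); exact: cf.
Qed.

Lemma open_shadows e a L y : open [set z | shadows e a L y z].
Proof.
elim: L => [|L ih].
  rewrite (_ : [set _ | _] = setT); first exact: openT.
  by apply/seteqP; split.
rewrite (_ : [set _ | _] = [set z | shadows e a L y z] `&`
    iter (a + L) f @^-1` [set z | mdist (iter L f y) z < e]).
  apply: openI ih _; apply: open_comp; last exact: open_mdist_lt.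
  by move=> z _; exact: continuous_iter.
apply/seteqP; split=> z /=.
  by move=> h; split=> [k kL|]; apply: h; rewrite ?ltnS// ltnW.
by move=> [h1 h2] k; rewrite ltnS leq_eqVlt => /predU1P[->|/h1].
Qed.

(** The gap required after a segment depends only on the length of that segment, here 1, so the
    delay is [M 1 d] whatever [L] is. *)
Lemma specification_shadow (M : nat -> R -> nat) : nonuniform_specification f M ->
  forall (U : set X) e, open U -> U !=set0 -> 0 < e ->
  exists a, forall L y, exists2 z, U z & shadows e a L y z.
Proof.
move=> [[Mpos _ _] spec] U e oU [x Ux] e0.
have [r /= r0 rU] : nbhs_ball x U by apply/nbhs_ballP; exact: open_nbhs_nbhs.
(* Specification gives [<=], while the ball and [shadows] ask for [<]; hence a [d] strictly below
   both radii. *)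
pose d := Num.min r e / 2.
have d0 : 0 < d by rewrite divr_gt0// lt_min r0.
have [dr de] : d < r /\ d < e.
  by move: r0 e0; rewrite /d; case: (leP r e) => *; split; lra.
have M0 := Mpos 1%N d isT d0; exists (M 1%N d) => -[|L] y.
  by exists x.
(* The point [x] occupies the single time 0 and [y] the [L + 1] times from [M 1 d] on; length 0 was
   settled by [x] itself. *)
pose A i : nat := if i is 0%N then 0%N else M 1%N d.
pose B i : nat := if i is 0%N then 0%N else (M 1%N d + L)%N.
have [||z zP] := spec d d0 2%N isT (fun i => if i is 0%N then x else y) A B.
- by case=> [|i] _; rewrite /A /B ?leq_addr.
- by case=> [_|//]; split; rewrite // /A /B !subn0.
exists z.
  apply: rU; rewrite ballEmdist/=.
  by have := zP 0%N isT 0%N isT; rewrite subnn/= => /le_lt_trans; apply.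
move=> k; rewrite ltnS => kL.
have := zP 1%N isT (M 1%N d + k)%N.
rewrite /= leq_addr leq_add2l kL => /(_ isT).
by rewrite addKn => /le_lt_trans; apply.
Qed.

(** The first [a] terms and the change of denominator from [L] to [a + L] each cost at most
    [C * (a / L)]; the shadowed terms cost at most [w]. *)
Lemma birkhoff_shadow (phi : X -> R) (C w e : R) a L y z :
  (0 < L)%N -> (forall x, `|phi x| <= C) ->
  (forall x x', mdist x x' < e -> `|phi x - phi x'| < w) ->
  shadows e a L y z ->
  `|birkhoff_average f phi z (a + L) - birkhoff_average f phi y L|
    <= 2 * C * (a%:R / L%:R) + w.
Proof.
move=> L0 phiC phie sh.
pose Sy := \sum_(k < L) phi (iter k f y).
pose Sa := \sum_(k < a) phi (iter k f z).
pose Sz := \sum_(k < L) phi (iter (a + k) f z).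
have Lr : 0 < L%:R :> R by rewrite ltr0n.
have ar : 0 <= a%:R :> R by rewrite ler0n.
have w0 : 0 < w.
  have := sh 0%N L0; rewrite /= => /phie; exact: le_lt_trans.
have bnd (n : nat) (g : nat -> X) : `|\sum_(k < n) phi (g k)| <= n%:R * C.
  rewrite (le_trans (ler_norm_sum _ _ _))//.
  rewrite (@le_trans _ _ (\sum_(k < n) C))//; first exact: ler_sum.
  by rewrite sumr_const card_ord mulr_natl.
have SyC : `|Sy| <= L%:R * C by exact: (bnd L (fun k => iter k f y)).
have SaC : `|Sa| <= a%:R * C by exact: (bnd a (fun k => iter k f z)).
have Szy : `|Sz - Sy| <= L%:R * w.
  rewrite /Sz /Sy -sumrB (le_trans (ler_norm_sum _ _ _))//.
  rewrite (@le_trans _ _ (\sum_(k < L) w))//; last first.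
    by rewrite sumr_const card_ord mulr_natl.
  by apply: ler_sum => k _; rewrite distrC; apply: ltW; exact/phie/sh.
have C0 : 0 <= C by exact: le_trans (normr_ge0 _) (phiC y).
have -> : birkhoff_average f phi z (a + L) - birkhoff_average f phi y L =
    (a + L)%:R^-1 * (Sa + (Sz - Sy)) - a%:R / (a + L)%:R * (Sy / L%:R).
  rewrite /birkhoff_average big_split_ord/= -/Sa -/Sy -/Sz natrD.
  by field; apply/andP; split; rewrite gt_eqF//; lra.
have aL : 0 < (a + L)%:R :> R by rewrite natrD; lra.
set u := (a + L)%:R^-1; set v := L%:R^-1.
have u0 : 0 <= u by rewrite invr_ge0 ltW.
have uv : u <= v by rewrite lef_pV2 ?posrE// natrD; lra.
have vL : v * L%:R = 1 by rewrite mulVf// gt_eqF.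
clearbody u v.
have t1 : `|u * (Sa + (Sz - Sy))| <= C * (a%:R * v) + w.
  rewrite normrM (ger0_norm u0).
  have -> : C * (a%:R * v) + w = v * (a%:R * C + L%:R * w).
    by rewrite mulrDr [v * (L%:R * w)]mulrA vL; ring.
  by rewrite ler_pM// (le_trans (ler_normD _ _))// lerD.
have t2 : `|a%:R * u * (Sy * v)| <= C * (a%:R * v).
  have -> : C * (a%:R * v) = a%:R * v * (L%:R * C * v).
    transitivity (C * (a%:R * v) * (v * L%:R)); first by rewrite vL mulr1.
    by ring.
  have v0 : 0 <= v by exact: le_trans uv.
  rewrite normrM (ger0_norm (x := a%:R * u)) ?mulr_ge0// normrM (ger0_norm v0).
  by rewrite ler_pM ?mulr_ge0// ?ler_wpM2l// ler_wpM2r.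
rewrite (le_trans (ler_normB _ _))//.
by rewrite (le_trans (lerD t1 t2))//; lra.
Qed.
End shadowing.

(** * Universal points form a residual set *)

Section universal_points.
Context {R : realType} {X : pointedMetricType R}.
Variable f : X -> X.
Hypotheses (compactX : compact [set: X]) (cf : continuous f).

(** The single parameter [N] governs the precision, the length and the ratio [a / L] at once, so
    that membership for all [N] forces delays negligible against [L]. *)
Definition shadows_often (y : X) (S : set nat) (N : nat) : set X :=
  [set z | exists a L, [/\ S L, (N < L)%N, (a * N <= L)%N &
                           shadows f N.+1%:R^-1 a L y z]].

Lemma open_shadows_often y S N : open (shadows_often y S N).
Proof.
rewrite (_ : shadows_often _ _ _ = \bigcup_(p in [set p : nat * nat |
    [/\ S p.2, (N < p.2)%N & (p.1 * N <= p.2)%N]])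
    [set z | shadows f N.+1%:R^-1 p.1 p.2 y z]).
  by apply: bigcup_open => p _; exact: open_shadows.
apply/seteqP; split=> z /=.
  by move=> [a [L [SL NL aL sh]]]; exists (a, L).
by move=> [[a L] /= [SL NL aL] sh]; exists a, L.
Qed.

(** The delay [a] belonging to [U] is fixed first; the unbounded [S] then supplies a length beyond
    both [N] and [a * N]. *)
Lemma dense_shadows_often (M : nat -> R -> nat) y S N :
  nonuniform_specification f M -> (forall n, exists2 m, (n <= m)%N & S m) ->
  dense (shadows_often y S N).
Proof.
move=> spec Sinf U U0 oU.
have e0 : 0 < N.+1%:R^-1 :> R by rewrite invr_gt0.
have [a aP] := specification_shadow spec oU U0 e0.
have [L + SL] := Sinf (maxn N.+1 (a * N)); rewrite geq_max => /andP[NL aL].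
by have [z Uz sh] := aP L y; exists z; split=> //; exists a, L.
Qed.

Lemma shadows_often_average (Phi : nat -> X -> R) k y S z (d : R) (N : nat) :
  (forall i, (i < k)%N -> continuous (Phi i)) ->
  (forall n, shadows_often y S n z) -> 0 < d ->
  exists n L, [/\ (N <= n)%N, S L & forall i, (i < k)%N ->
    `|birkhoff_average f (Phi i) z n - birkhoff_average f (Phi i) y L| < d].
Proof.
move=> cPhi often d0; have d20 : 0 < d / 2 by rewrite divr_gt0.
have [C [e [C0 e0 PhiC Phie]]] := continuous_family_control compactX cPhi d20.
have [m1 _ /(_ m1 (leqnn _)) /= m1e] := near_infty_natSinv_lt (PosNum e0).
(* With [a / L] below this value, [2 * C * (a / L)] stays under [d / 2]; [C + 1] avoids a zero
   denominator. *)
have C4 : 0 < d / (4 * (C + 1)).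
  by rewrite divr_gt0// mulr_gt0//; lra.
have [m2 _ /(_ m2 (leqnn _)) /= m2C] := near_infty_natSinv_lt (PosNum C4).
pose m := maxn N (maxn m1.+1 m2.+1).
have [Nm m1m m2m] : [/\ N <= m, m1 < m & m2 < m]%N.
  by rewrite /m !leq_max !leqnn !orbT.
have [a [L [SL mL aL sh]]] := often m; exists (a + L)%N, L; split=> //.
  by rewrite (leq_trans Nm)// (leq_trans (ltnW mL))// leq_addl.
move=> i ik.
have L0 : (0 < L)%N by exact: leq_trans mL.
have Phim x x' : mdist x x' < m.+1%:R^-1 -> `|Phi i x - Phi i x'| < d / 2.
  move=> xx'; apply: Phie => //; apply: (lt_trans xx'); apply: le_lt_trans m1e.
  by rewrite lef_pV2 ?posrE// ler_nat ltnW.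
have := birkhoff_shadow L0 (fun x => PhiC i x ik) Phim sh.
move=> /le_lt_trans; apply.
have aLm : a%:R / L%:R <= m2.+1%:R^-1 :> R.
  rewrite ler_pdivrMr ?ltr0n// mulrC ler_pdivlMr ?ltr0n// -natrM ler_nat.
  by rewrite (leq_trans _ aL)// leq_mul2l m2m orbT.
have : 2 * C * (a%:R / L%:R) <= 2 * C * (d / (4 * (C + 1))).
  by rewrite ler_wpM2l ?mulr_ge0// (le_trans aLm)// ltW.
have : 2 * C * (d / (4 * (C + 1))) < d / 2.
  rewrite mulrA ltr_pdivrMr; last lra.
  have -> : d / 2 * (4 * (C + 1)) = 2 * C * d + 2 * d by field.
  lra.
lra.
Qed.

(** A joint limit point: the same time [n] serves all [k] averages. *)
Definition average_cluster (k : nat) (Phi : nat -> X -> R) (v : nat -> R)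
    (x : X) : Prop :=
  forall d N, 0 < d -> exists2 n, (N <= n)%N &
    forall i, (i < k)%N -> `|birkhoff_average f (Phi i) x n - v i| < d.

(* Such a [z] sees every weak-* limit measure of every orbit. *)
Definition universal : set X := [set z | forall x k Phi v,
  (forall i, (i < k)%N -> continuous (Phi i)) ->
  average_cluster k Phi v x -> average_cluster k Phi v z].

(* The pattern [(j, [:: (m0, q0); ...])] asks that the average of each [F mi] be
   within [1 / (j + 1)] of [qi]. *)
Definition pattern := (nat * seq (nat * rat))%type.

Definition matches (F : nat -> X -> R) (p : pattern) (x : X) : set nat := [set n |
  forall i, (i < size p.2)%N ->
    `|birkhoff_average f (F (nth (0%N, 0) p.2 i).1) x n
      - ratr (nth (0%N, 0) p.2 i).2| < p.1.+1%:R^-1].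

Definition often (S : set nat) := forall n, exists2 m, (n <= m)%N & S m.

Lemma birkhoff_average_near (phi psi : X -> R) (w : R) x n :
  0 <= w -> (forall x, `|phi x - psi x| <= w) ->
  `|birkhoff_average f phi x n - birkhoff_average f psi x n| <= w.
Proof.
move=> w0 near; rewrite /birkhoff_average -mulrBr -sumrB normrM.
case: n => [|n]; first by rewrite invr0 normr0 mul0r.
rewrite ger0_norm ?invr_ge0// ler_pdivrMl ?ltr0n//.
rewrite (le_trans (ler_norm_sum _ _ _))//.
rewrite (@le_trans _ _ (\sum_(k < n.+1) w))//; first exact: ler_sum.
by rewrite sumr_const card_ord mulr_natl.
Qed.

Section patterns.
Variable F : nat -> X -> R.
Hypothesis approx : forall phi : X -> R, continuous phi -> forall w, 0 < w ->
  exists m, forall x, `|phi x - F m x| < w.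

(** Near a limit point [v] of the averages of [x] there is a pattern [p] that [x] matches infinitely
    often. Then [y p] matches [p] at every time of [S p], and [z] imitates [y p] over such times. *)
Lemma patterns_universal (y : pattern -> X) (S : pattern -> set nat) :
  (forall p x, often (matches F p x) -> S p `<=` matches F p (y p)) ->
  \bigcap_p \bigcap_N shadows_often (y p) (S p) N `<=` universal.
Proof.
move=> SP z zP x k Phi v cPhi clx d N d0.
have d40 : 0 < d / 8 by rewrite divr_gt0.
have [j _ /(_ j (leqnn _)) /= jd] := near_infty_natSinv_lt (PosNum d40).
(* A quarter of the pattern tolerance. For [x], approximation, rounding and distance to [v] cost [w]
   each, which fits in [4 * w]; for [z] the total error is at most [d / 2 + 6 * w], below [d]. *)
pose w : R := j.+1%:R^-1 / 4.
have w0 : 0 < w by rewrite divr_gt0.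
have wE : j.+1%:R^-1 = 4 * w by rewrite /w; field.
have /choice[m mP] : forall i, exists m, (i < k)%N -> forall x, `|Phi i x - F m x| < w.
  move=> i; have [ik|ik] := ltnP i k; last by exists 0%N.
  by have [m mP] := approx (cPhi i ik) w0; exists m.
have /choice[q qP] : forall i, exists q : rat, `|v i - ratr q| < w.
  move=> i; have [|q] := @rat_in_itvoo _ (v i - w) (v i + w); first by lra.
  by rewrite in_itv/= => /andP[h1 h2]; exists q; rewrite ltr_norml; lra.
pose p : pattern := (j, mkseq (fun i => (m i, q i)) k).
have mE x' n : matches F p x' n <-> forall i, (i < k)%N ->
    `|birkhoff_average f (F (m i)) x' n - ratr (q i)| < 4 * w.
  rewrite /matches/= size_mkseq -wE.
  by split=> h i ik; have := h i ik; rewrite nth_mkseq.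
have often_x : often (matches F p x).
  move=> n0; have [n n0n nP] := clx w n0 w0; exists n => //.
  apply/mE => i ik; have := nP i ik; have := qP i.
  have := birkhoff_average_near x n (ltW w0) (fun x => ltW (mP i ik x)).
  by rewrite ler_norml !ltr_norml => /andP[? ?] /andP[? ?] /andP[? ?]; lra.
have d20 : 0 < d / 2 by rewrite divr_gt0.
have [n [L [Nn SL nP]]] := shadows_often_average N cPhi (fun n => zP p I n I) d20.
exists n => // i ik.
have /mE/(_ i ik) := SP p x often_x L SL.
have := nP i ik; have := qP i.
have := birkhoff_average_near (y p) L (ltW w0) (fun x => ltW (mP i ik x)).
rewrite wE in jd; clearbody w; rewrite ler_norml !ltr_norml.
by move=> /andP[? ?] /andP[? ?] /andP[? ?] /andP[? ?]; lra.
Qed.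

End patterns.

Lemma universal_residual (M : nat -> R -> nat) : nonuniform_specification f M ->
  exists O : nat -> set X, (forall i, open (O i) /\ dense (O i)) /\
    \bigcap_i O i `<=` universal.
Proof.
move=> spec; have [F approx] := countable_uniform_approx compactX.
(* One orbit per pattern represents all orbits that match it infinitely often. *)
have /choice[y yP] : forall p, exists y,
    forall x, often (matches F p x) -> often (matches F p y).
  move=> p; have [[x h]|no] := pselect (exists x, often (matches F p x)).
    by exists x.
  by exists point => x h; case: no; exists x.
(* For a pattern that no orbit matches infinitely often, this is all of [nat], so [S p] is unbounded
   in every case. *)
pose S p := [set n | often (matches F p (y p)) -> matches F p (y p) n].
have Sinf p : often (S p).
  move=> n; have [h|no] := pselect (often (matches F p (y p))).
    by have [m nm mP] := h n; exists m.
  by exists n => // /no.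
(* The pairs [(p, N)] are countable; integers that code no pair receive the whole space. *)
exists (fun i => if choice.unpickle i is Some (p, N) then
  shadows_often (y p) (S p) N else setT); split.
  move=> i; case: choice.unpickle => [[p N]|].
    by split; [exact: open_shadows_often|apply: (@dense_shadows_often M) => //; exact: Sinf].
  by split; [exact: openT|move=> U U0 _; rewrite setIT].
apply: subset_trans (@patterns_universal F approx y S _); last first.
  by move=> p x h n; apply; exact: yP h.
by move=> z zP p _ N _; have := zP (choice.pickle (p, N)) I; rewrite choice.pickleK.
Qed.

End universal_points.

(** * Weak-* limits of empirical measures through Birkhoff averages *)

Lemma ptws_nbhs_basis (R : realType) (U : Type) (u0 : U) (p : {ptws U -> R})
    (W : set {ptws U -> R}) : nbhs p W ->
  exists (s : seq U) (d : R), 0 < d /\ forall g : U -> R,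
    (forall i, (i < size s)%N -> `|g (nth u0 s i) - p (nth u0 s i)| < d) -> W g.
Proof.
(* Sets containing a box on finitely many coordinates form a filter; its convergence to [p] is
   checked one coordinate at a time. *)
pose basic (A : set (U -> R)) := exists (s : seq U) (d : R), 0 < d /\
  forall g : U -> R,
  (forall i, (i < size s)%N -> `|g (nth u0 s i) - p (nth u0 s i)| < d) -> A g.
have Fbasic : Filter basic.
  split.
  - by exists [::], 1; split.
  - move=> A B [s1 [d1 [d10 sA]]] [s2 [d2 [d20 sB]]].
    exists (s1 ++ s2), (Num.min d1 d2); rewrite lt_min d10; split=> // g gP; split.
      apply: sA => i i1; have := gP i; rewrite nth_cat i1 size_cat lt_min.
      by rewrite ltn_addr// => /(_ isT)/andP[].
    apply: sB => i i1; have := gP (size s1 + i)%N.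
    have -> : nth u0 (s1 ++ s2) (size s1 + i)%N = nth u0 s2 i.
      by rewrite nth_cat (ltnNge _ (size s1)) leq_addr/= addKn.
    rewrite size_cat ltn_add2l lt_min.
    by move=> /(_ i1)/andP[].
  - move=> A B AB [s [d [d0 sA]]]; exists s, d; split=> // g gP.
    by apply: AB; exact: sA.
suff cvgp : {ptws, (basic : set_system (U -> R)) --> (p : U -> R)} by exact: cvgp.
apply/cvg_sup => u A [_ [[V oV <-] Vp VA]].
have /nbhs_ballP[e /= e0 eV] : nbhs (p u) V by exact: open_nbhs_nbhs.
exists [:: u], e; split=> // g /(_ 0%N isT)/= gu; apply: VA; apply: eV.
by rewrite /ball/= distrC.
Qed.

Section empirical_limits.
Context {R : realType} {X : pointedMetricType R}.
Variable f : X -> X.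

Lemma continuous_borel_measurable (phi : X -> R) :
  continuous phi -> measurable_fun [set: borel X] (phi : borel X -> R).
Proof.
move=> /continuousP cphi; apply: (measurability _ (RGenOpens.measurableE R)).
move=> _ [_ [a [b ->]] <-]; rewrite setTI; apply: sub_sigma_algebra.
by apply: cphi; exact: interval_open.
Qed.

Lemma integral_empirical (phi : X -> R) x n : continuous phi ->
  \int[empirical f x n]_y phi y = birkhoff_average f phi x n.+1.
Proof.
move=> cphi; have mphi := continuous_borel_measurable cphi.
(* Nonnegative functions integrate termwise against the Dirac masses; the real integral follows from
   positive and negative parts. *)
have ge0 (psi : borel X -> \bar R) : (forall y, 0 <= psi y)%E ->
    measurable_fun [set: borel X] psi ->
    (\int[empirical f x n]_y psi y =
      (n.+1%:R^-1)%:E * \sum_(k < n.+1) psi (iter k f x))%E.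
  move=> psi0 mpsi; rewrite ge0_integral_mscale//=; congr (_ * _)%E.
  rewrite ge0_integral_measure_sum//; apply: eq_bigr => k _.
  by rewrite integral_dirac// diracT mul1e.
have mE : measurable_fun [set: borel X] (EFin \o phi : borel X -> \bar R).
  exact/measurable_EFinP.
rewrite /Rintegral integralE !ge0//; [|exact: measurable_funeneg|exact: measurable_funepos].
under [X in (_ * X - _)%E]eq_bigr do rewrite funeposE -EFin_max.
under [X in (_ - _ * X)%E]eq_bigr do rewrite funenegE -EFinN -EFin_max.
rewrite !sumEFin -!EFinM -EFinB/= -mulrBr -sumrB /birkhoff_average.
congr (_ * _); apply: eq_bigr => k _.
by case: (leP (phi _) 0); case: (leP (- phi _) 0); lra.
Qed.

Lemma limit_measures_average_cluster x mu k (Phi : nat -> continuousType X R) :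
  limit_measures f x mu ->
  average_cluster f k (fun i => Phi i) (fun i => \int[mu]_y Phi i y) x.
Proof.
move=> lim d N d0.
have nb : nbhs (mu : weak_star) [set nu : probability (borel X) R |
    forall i, (i < k)%N -> `|\int[nu]_y Phi i y - \int[mu]_y Phi i y| < d].
  elim: k => [|k ih]; first by apply: filterS filterT => nu _ i.
  have nbk : nbhs (mu : weak_star) [set nu : probability (borel X) R |
      `|\int[nu]_y Phi k y - \int[mu]_y Phi k y| < d].
    (* Integration of [Phi k] is the map defining the initial topology followed by a coordinate
       projection, hence continuous. *)
    pose I (nu : weak_star) : {ptws continuousType X R -> R} :=
      fun phi => \int[nu : probability (borel X) R]_y phi y.
    have cI : continuous I by exact: initial_continuous.
    have cp : continuous (fun g : {ptws continuousType X R -> R} => g (Phi k)).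
      exact: proj_continuous.
    have : continuous (fun nu : weak_star => I nu (Phi k)).
      by move=> nu; exact: (@continuous_comp _ _ _ I (fun g => g (Phi k)) nu (cI nu) (cp _)).
    move=> /(_ mu)/cvgrPdist_lt/(_ _ d0); apply: filterS => nu /=.
    by rewrite distrC.
  apply: filterS (filterI ih nbk) => nu [h1 h2] i.
  by rewrite ltnS leq_eqVlt => /predU1P[->//|/h1].
pose A : set weak_star := [set nu | exists2 n, (N <= n)%N &
  nu = (empirical f x n : weak_star)].
have FA : ((fun n => empirical f x n : weak_star) @ \oo) A.
  by exists N => // n Nn; exists n.
have [_ [[n Nn ->] nP]] := lim _ _ FA nb.
exists n.+1; first exact: leqW.
by move=> i ik; have := nP i ik; rewrite integral_empirical//; exact: cts_fun.
Qed.

(** A weak-* neighbourhood contains one that tests finitely many integrals, so being a limit measure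
    is a statement about joint limit points of finitely many averages, which universal points
    inherit. *)
Lemma universal_limit_measures x z : universal f z ->
  limit_measures f x `<=` limit_measures f z.
Proof.
move=> uz mu lim A B [N _ NA] nB.
have [V [oV Vmu] VB] : exists2 V : set {ptws continuousType X R -> R},
   open V /\ V (fun phi => \int[mu]_y phi y) & forall nu : probability (borel X) R,
   V (fun phi => \int[nu]_y phi y) -> B nu.
  by move: nB => [_ [[V oV <-] Vmu VB]]; exists V => // nu; exact: VB.
pose phi0 : continuousType X R := cst 0.
have [s [d [d0 sV]]] := ptws_nbhs_basis phi0 (open_nbhs_nbhs (conj oV Vmu)).
have := uz x (size s) (fun i => nth phi0 s i) (fun i => \int[mu]_y (nth phi0 s i) y).
have cs i : (i < size s)%N -> continuous (nth phi0 s i : X -> R).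
  by move=> _; exact: cts_fun.
move=> /(_ cs (limit_measures_average_cluster _ _ lim)).
(* The bound [N.+1] absorbs the index shift: the empirical measure of index [n] averages over
   [n + 1] points. *)
move=> /(_ d N.+1 d0)[[//|n]]; rewrite ltnS => Nn nP.
exists (empirical f z n : weak_star); split; first exact: NA.
apply: VB; apply: sV => i ik; rewrite integral_empirical; first exact: nP.
exact: cs.
Qed.

Lemma average_cluster1P (phi : X -> R) v x :
  average_cluster f 1 (fun=> phi) (fun=> v) x <->
  cluster (birkhoff_average f phi x @ \oo) v.
Proof.
split=> [clv|/cluster_eventuallyP clv d N d0].
  apply/cluster_eventuallyP => e N e0; have [n Nn /(_ 0%N isT) nP] := clv e N e0.
  by exists n => //; rewrite distrC ltW.
have [n Nn nP] := clv (d / 2) N (divr_gt0 d0 (ltr0n _ 2)).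
by exists n => // i _; rewrite distrC (le_lt_trans nP)// ltr_pdivrMr//; lra.
Qed.

(** If the averages of [z] converged, those of [x], whose limit points all pass to [z], would have a
    single limit point and, being bounded, converge too. *)
Lemma universal_irregular (phi : X -> R) x z : compact [set: X] ->
  continuous phi -> universal f z -> irregular_set f phi x -> irregular_set f phi z.
Proof.
move=> compactX cphi uz irrx cvgz; apply: irrx.
have clE v w : cluster (birkhoff_average f phi x @ \oo) v ->
    cluster (birkhoff_average f phi x @ \oo) w -> v = w.
  have clz u : cluster (birkhoff_average f phi x @ \oo) u ->
      cluster (birkhoff_average f phi z @ \oo) u.
    by move=> /average_cluster1P/uz h; apply/average_cluster1P; apply: h.
  have limE u : cluster (birkhoff_average f phi x @ \oo) u ->
      limn (birkhoff_average f phi z) = u.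
    move=> /clz clu; apply: norm_hausdorff => A B nA nB.
    exact: (clu A B (cvgz A nA) nB).
  by move=> /limE <- /limE <-.
have [C C0 phiC] := compact_fun_bounded compactX cphi.
have bnd n : `|birkhoff_average f phi x n| <= C.
  have := @birkhoff_average_near _ _ f phi (fun=> 0) C x n C0.
  rewrite {2}/birkhoff_average big1// mulr0 subr0; apply=> y.
  by rewrite subr0.
(* The margin 1 makes the segment a neighbourhood of the limit point [v], which satisfies
   [|v| <= C]. *)
have inC : (birkhoff_average f phi x @ \oo) `[- C - 1, C + 1]%classic.
  by exists 0%N => // n _ /=; have := bnd n; rewrite in_itv/= ler_norml; lra.
have [v [_ clv]] := @segment_compact R _ _ _ (fmap_proper_filter (birkhoff_average f phi x) eventually_filter) inC.
have vC : `|v| <= C.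
  apply/ler_addgt0Pl => e e0.
  have /cluster_eventuallyP/(_ e 0%N e0)[n _ nP] := clv.
  by have := bnd n; move: nP; rewrite !ler_norml; lra.
apply/cvg_ex; exists v.
apply: (compact_cluster_set1 (@norm_hausdorff _ R) (@segment_compact R (- C - 1) (C + 1))) => //.
- apply: filterS (near_in_itvoo (x := v) _); first exact: subset_itv_oo_cc.
  by rewrite in_itv/=; move: vC; rewrite ler_norml; lra.
- by apply/seteqP; split=> [w clw|_ ->//]; exact: clE clv.
Qed.

End empirical_limits.

(** * Sums grouped by level, limits at 0 and upper limits *)

Lemma sum_by_level (R : realDomainType) (T : eqType) (s : seq T) (n : T -> nat) (N m : nat)
    (g c : nat -> R) :
  (forall k, k \in s -> (N <= n k < m)%N) -> (forall l, 0 <= g l) ->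
  (forall l, (N <= l)%N -> (count (fun k => n k == l) s)%:R <= c l) ->
  \sum_(k <- s) g (n k) <= \sum_(N <= l < m) c l * g l.
Proof.
move=> sn g0 sc.
(* Each term is spread over the levels by an indicator; exchanging the sums then counts the indices
   on each level. *)
have -> : \sum_(k <- s) g (n k) = \sum_(k <- s) \sum_(N <= l < m) (n k == l)%:R * g l.
  apply: eq_big_seq => k /sn nk.
  rewrite (big_rem (n k)) ?mem_index_iota//= eqxx mul1r big_seq big1 ?addr0// => l.
  rewrite mem_rem_uniq ?iota_uniq// inE eq_sym => /andP[/negbTE -> _].
  by rewrite mul0r.
rewrite exchange_big/= big_nat [leRHS]big_nat; apply: ler_sum => l /andP[Nl _].
rewrite -mulr_suml ler_wpM2r// -natr_sum.
rewrite (eq_bigr (fun k => if n k == l then 1 else 0)%N); last by move=> k _; case: eqP.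
by rewrite -big_mkcond/= sum1_count sc.
Qed.

Lemma geometric_sum_le (R : realFieldType) (q : R) (N m : nat) :
  0 < q < 1 -> \sum_(N <= l < m) q ^+ l <= q ^+ N / (1 - q).
Proof.
move=> /andP[q0 q1]; have q1' : 0 < 1 - q by rewrite subr_gt0.
rewrite ler_pdivlMr// mulr_suml.
have [Nm|mN] := leqP N m; last first.
  by rewrite big_geq 1?ltnW// exprn_ge0// ltW.
have -> : \sum_(N <= l < m) q ^+ l * (1 - q) = q ^+ N - q ^+ m.
  rewrite -[RHS]opprB -(telescope_sumr (fun l => q ^+ l) Nm) -sumrN.
  by apply: eq_bigr => l _; rewrite exprSr; ring.
by rewrite gerBl exprn_ge0// ltW.
Qed.

(** Turns both entropies into suprema over scales, so that they can be compared scale by scale. *)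
Lemma lim_at_right0_sup (R : realType) (g : R -> \bar R) :
  (forall e1 e2, 0 < e1 -> e1 <= e2 -> (g e2 <= g e1)%E) ->
  lim (g e @[e --> 0^'+]) = ereal_sup [set g e | e in [set e | 0 < e]].
Proof.
move=> gmono; apply: cvg_lim => //.
have -> : [set e : R | 0 < e] = [set` Interval (BRight 0) +oo%O].
  by apply/seteqP; split=> e /=; rewrite in_itv/= andbT.
apply: nonincreasing_at_right_cvge => // e1 e2.
by rewrite !in_itv/= !andbT => e10 _; exact: gmono.
Qed.

Lemma le_limn_esup (R : realType) (u v : nat -> \bar R) :
  (forall n, (u n <= v n)%E) -> (limn_esup u <= limn_esup v)%E.
Proof.
move=> uv; rewrite !limn_esup_lim; apply: lee_lim; try exact: is_cvg_esups.
apply: nearW => n; apply: ge_ereal_sup => _ [k nk <-].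
by rewrite (le_trans (uv k))//; apply: ereal_sup_ubound; exists k.
Qed.

Lemma limn_esup_lt_near (R : realType) (u : nat -> \bar R) (r : \bar R) :
  (limn_esup u < r)%E -> exists N, forall n, (N <= n)%N -> (u n < r)%E.
Proof.
rewrite limn_esup_lim.
have [[N uN] _|no] := pselect (exists N, (esups u N < r)%E); last first.
  rewrite ltNge => /negP[]; apply: lime_ge; first exact: is_cvg_esups.
  by apply: nearW => N; rewrite leNgt; apply/negP => uN; apply: no; exists N.
exists N => n Nn; apply: le_lt_trans uN.
by apply: ereal_sup_ubound; exists n.
Qed.

Lemma limn_esup_gt_often (R : realType) (u : nat -> \bar R) (r : \bar R) N :
  (r < limn_esup u)%E -> exists2 n, (N <= n)%N & (r < u n)%E.
Proof.
rewrite limn_esup_lim => ru.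
have : (r < esups u N)%E.
  apply: lt_le_trans ru _; apply: lime_le; first exact: is_cvg_esups.
  exists N => // n /= Nn; apply: ereal_sup_le => _ [k /= nk <-].
  by exists k => //=; exact: leq_trans nk.
by move=> /ereal_sup_gt[_ [n /= Nn <-] rn]; exists n.
Qed.

(** * Bowen metrics and monotonicity of the entropies in the scale *)

Section bowen.
Context {R : realType} {X : pointedMetricType R}.
Variable f : X -> X.

Lemma mdist_le_bowen n x y i : (i < n)%N ->
  mdist (iter i f x) (iter i f y) <= bowen_dist f n x y.
Proof.
move=> ni; rewrite /bowen_dist.
exact: (le_bigmax 0 (fun i : 'I_n => mdist (iter i f x) (iter i f y)) (Ordinal ni)).
Qed.

Lemma bowen_dist_leP n x y c : 0 <= c ->
  (forall i, (i < n)%N -> mdist (iter i f x) (iter i f y) <= c) ->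
  bowen_dist f n x y <= c.
Proof. by move=> c0 h; apply: bigmax_le => // i _; exact: h. Qed.

Lemma bowen_dist_gtP n x y c : 0 <= c -> c < bowen_dist f n x y ->
  exists2 i, (i < n)%N & c < mdist (iter i f x) (iter i f y).
Proof.
move=> c0 /bigmax_gtP[|[i _ ci]]; first by rewrite ltNge c0.
by exists i.
Qed.

Lemma bowen_ball_center n x e : 0 < e -> bowen_ball f n x e x.
Proof.
by move=> e0; apply: bigmax_lt => // i _; rewrite mdistxx.
Qed.

Lemma closure_bowen_ball n x e y : continuous f -> 0 < e ->
  closure (bowen_ball f n x e) y -> bowen_dist f n x y <= e.
Proof.
move=> cf e0 cl; apply: bowen_dist_leP; first exact: ltW.
move=> i ni; apply/ler_addgt0Pl => d d0.
have ny : nbhs y (iter i f @^-1` [set z | mdist (iter i f y) z < d]).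
  apply: (@continuous_iter _ _ _ cf i y).
  by apply: open_nbhs_nbhs; split; [exact: open_mdist_lt|rewrite /= mdistxx].
have [z [xz /= yz]] := cl _ ny.
rewrite (le_trans (metric_triangle _ (iter i f z) _))// addrC lerD//.
  by rewrite metric_sym ltW.
exact/ltW/(le_lt_trans (mdist_le_bowen _ _ ni)).
Qed.

Lemma separated_number_ge1 n e : (1 <= separated_number f n e)%E.
Proof.
apply: ereal_sup_ubound; exists [fset point]%fset; last by rewrite /= cardfs1.
by move=> x y; rewrite !inE => /eqP-> /eqP->; rewrite eqxx.
Qed.

Lemma htop_scale_ge0 e : (0 <= htop_scale f e)%E.
Proof.
rewrite -[leLHS](_ : limn_esup (fun=> 0%E) = 0%E).
  apply: le_limn_esup => n; apply: mule_ge0; last first.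
    by rewrite lne_ge0 separated_number_ge1.
  by rewrite lee_fin invr_ge0.
by rewrite (cvg_limn_einf_sup (cvg_cst _)).2.
Qed.

Lemma htop_scale_nonincreasing e1 e2 : e1 <= e2 ->
  (htop_scale f e2 <= htop_scale f e1)%E.
Proof.
move=> e12; apply: le_limn_esup => n; apply: lee_wpmul2l.
  by rewrite lee_fin invr_ge0.
have s0 e : (0 <= separated_number f n e)%E.
  by apply: le_trans (separated_number_ge1 n e); rewrite lee_fin.
rewrite lee_lne ?in_itv/= ?s0 ?leey//.
apply: ereal_sup_le => _ [A sepA <-]; exists A => // x y xA yA xy.
exact: le_lt_trans (sepA x y xA yA xy).
Qed.

Lemma htopE : htop f = ereal_sup [set htop_scale f e | e in [set e | 0 < e]].
Proof. by apply: lim_at_right0_sup => e1 e2 _; exact: htop_scale_nonincreasing. Qed.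

Lemma packing_QN_ge0 E t N e : (0 <= packing_QN f E t N e)%E.
Proof.
apply: ereal_sup_ubound; exists set0, (fun=> point), (fun=> 0%N); split.
  by split=> // k k' [].
by rewrite esum_set0.
Qed.

Lemma packing_QN_nonincreasing E t e :
  {homo packing_QN f E t ^~ e : N1 N2 / (N1 <= N2)%N >-> (N2 <= N1)%E}.
Proof.
move=> N1 N2 N12; apply: ereal_sup_le => _ [I [x [n [[adm triv] ->]]]].
exists I, x, n; split=> //; split=> // k /adm[Ex Nn]; split=> //.
exact: leq_trans Nn.
Qed.

Lemma packing_Q_ge0 E t e : (0 <= packing_Q f E t e)%E.
Proof.
apply: lime_ge; last by apply: nearW => N; exact: packing_QN_ge0.
exact/ereal_nonincreasing_is_cvgn/packing_QN_nonincreasing.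
Qed.

Lemma packing_P_ge0 E t e : (0 <= packing_P f E t e)%E.
Proof.
apply: le_ereal_inf_tmp => _ [F _ <-]; apply: nneseries_ge0 => j _ _.
exact: packing_Q_ge0.
Qed.

Lemma packing_P_nonincreasing E t e1 e2 : e1 <= e2 ->
  (packing_P f E t e2 <= packing_P f E t e1)%E.
Proof.
move=> e12; apply: le_ereal_inf_tmp => _ [F EF <-]; apply: ge_ereal_inf.
exists (\sum_(0 <= j <oo) packing_Q f (F j) t e2)%E; first by exists F.
apply: lee_nneseries => j _; first by move=> _; exact: packing_Q_ge0.
apply: lee_lim; try exact/ereal_nonincreasing_is_cvgn/packing_QN_nonincreasing.
apply: nearW => N; apply: ereal_sup_le => _ [I [x [n [[adm triv] ->]]]].
exists I, x, n; split=> //; split=> // k k' Ik Ik' [y [yk yk']].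
apply: triv => //; exists y; split.
  by apply: closure_subset yk => z /= /lt_le_trans; apply.
by apply: closure_subset yk' => z /= /lt_le_trans; apply.
Qed.

Lemma packing_entropy_scale_nonincreasing E e1 e2 : e1 <= e2 ->
  (packing_entropy_scale f E e2 <= packing_entropy_scale f E e1)%E.
Proof.
move=> e12; rewrite /packing_entropy_scale.
apply: le_ereal_inf_tmp => y [t [t0 Pt] <-].
have Pt0 : (packing_P f E t e2 <= 0)%E by rewrite -Pt packing_P_nonincreasing.
apply: ereal_inf_lbound; exists t; last by [].
by split; [exact: t0|apply: le_anti; rewrite Pt0 packing_P_ge0].
Qed.

Lemma packing_entropyE E : packing_entropy f E =
  ereal_sup [set packing_entropy_scale f E e | e in [set e | 0 < e]].
Proof.
apply: lim_at_right0_sup => e1 e2 _; exact: packing_entropy_scale_nonincreasing.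
Qed.

End bowen.

(** * Upper bound: packing entropy never exceeds topological entropy *)

Section upper_bound.
Context {R : realType} {X : pointedMetricType R}.
Variable f : X -> X.
Hypothesis cf : continuous f.

(** If two centres of order [l] were within [e / 2], one would lie in the other's ball. Halving [e]
    reconciles strict balls with strict separation. *)
Lemma packing_level_separated E N e (I : set nat) (x : nat -> X) (n : nat -> nat)
    (s : seq nat) l : 0 < e -> packing_admissible f E N e I x n -> uniq s ->
  (forall k, k \in s -> I k) ->
  ((count (fun k => n k == l) s)%:R%:E <= separated_number f l (e / 2))%E.
Proof.
move=> e0 [_ triv] us sI.
pose u := [seq k <- s | n k == l].
have sep k k' : k \in u -> k' \in u -> k != k' ->
    e / 2 < bowen_dist f l (x k) (x k').
  rewrite !mem_filter => /andP[/eqP nk ks] /andP[/eqP nk' ks'] kk'.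
  rewrite ltNge; apply/negP => close.
  move: kk' => /eqP; apply; apply: triv; [exact: sI|exact: sI|].
  exists (x k'); split; apply: subset_closure.
    rewrite /bowen_ball/= nk (le_lt_trans close)// ltr_pdivrMr//; lra.
  exact: bowen_ball_center.
have inj : {in u &, injective x}.
  move=> k k' ku ku' xx; apply/eqP/negPn/negP => /(sep _ _ ku ku').
  rewrite xx ltNge bowen_dist_leP ?divr_ge0 ?ltW// => i _.
  by rewrite mdistxx divr_ge0// ltW.
apply: ereal_sup_ubound; exists [fset y in [seq x k | k <- u]]%fset.
  move=> y y'; rewrite !inE => /mapP[k ku ->] /mapP[k' ku' ->] yy'.
  by apply: sep => //; apply: contraNneq yy' => ->.
rewrite /= card_fseq undup_id; last by rewrite map_inj_in_uniq// filter_uniq.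
by rewrite size_map size_filter.
Qed.

(** At most [expR (r * l)] balls of order [l], each of weight [expR (- (t * l))], give the tail of a
    geometric series of ratio [expR (r - t)]. *)
Lemma packing_QN_le_geometric E t r e N : 0 < e -> r < t -> (0 < N)%N ->
  (forall l, (N <= l)%N -> (separated_number f l (e / 2) <= (expR (r * l%:R))%:E)%E) ->
  (packing_QN f E t N e <= (expR (r - t) ^+ N / (1 - expR (r - t)))%:E)%E.
Proof.
move=> e0 rt N0 sepl; apply: ge_ereal_sup => _ [I [x [n [adm ->]]]].
apply: ge_ereal_sup => _ [A [finA AI] <-].
rewrite fsbig_finite//= sumEFin lee_fin.
set s := fset_set A.
have sI k : k \in s -> I k by rewrite in_fset_set// inE => /AI.
pose m := (\max_(k <- s) n k).+1.
apply: (@le_trans _ _ (\sum_(N <= l < m) expR (r * l%:R) * expR (- (t * l%:R)))).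
  apply: (sum_by_level (g := fun l => expR (- (t * l%:R)))).
  - move=> k ks; rewrite (adm.1 k (sI k ks)).2 ltnS.
    by apply: leq_bigmax_seq.
  - by move=> l; exact: expR_ge0.
  - move=> l Nl; rewrite -lee_fin; apply: le_trans (sepl l Nl).
    by apply: (packing_level_separated l e0 adm); [exact: fset_uniq|exact: sI].
rewrite (eq_bigr (fun l => expR (r - t) ^+ l)).
  by apply: geometric_sum_le; rewrite expR_gt0 expR_lt1 subr_lt0.
by move=> l _; rewrite -expRD -expRM_natr mulrBl.
Qed.

(** For an exponent above the entropy at scale [e / 2], the geometric tail vanishes as [N] grows;
    hence [packing_Q] of [E] is 0 and the constant cover by [E] suffices. *)
Lemma packing_entropy_scale_le E e : 0 < e ->
  (packing_entropy_scale f E e <= htop_scale f (e / 2))%E.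
Proof.
move=> e0; have := htop_scale_ge0 f (e / 2).
case hE : (htop_scale f (e / 2)) => [h| |//]; last by move=> _; rewrite leey.
rewrite lee_fin => h0; apply/lee_addgt0Pr => d d0; rewrite -EFinD.
apply: ereal_inf_lbound; exists (h + d); last by [].
split; first lra.
pose r := h + d / 2.
have [N sepN] : exists N, forall n, (N <= n)%N ->
    ((n%:R^-1)%:E * lne (separated_number f n (e / 2)) < r%:E)%E.
  by apply: limn_esup_lt_near; rewrite -/(htop_scale f (e/2)) hE lte_fin /r; lra.
have sepl l : (maxn 1 N <= l)%N ->
    (separated_number f l (e / 2) <= (expR (r * l%:R))%:E)%E.
  rewrite geq_max => /andP[l0 /sepN].
  have lr : 0 < l%:R :> R by rewrite ltr0n.
  have := separated_number_ge1 f l (e / 2).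
  case: separated_number => [s| |//]; last first.
    by rewrite /lne/= gt0_muley ?lte_fin ?invr_gt0.
  rewrite !lee_fin => s1; have s0 : 0 < s by lra.
  rewrite lne_EFin// -EFinM lte_fin mulrC ltr_pdivrMr// => sr.
  by rewrite -[s in s <= _]lnK ?posrE// ler_expR ltW.
have q01 : 0 < expR (r - (h + d)) < 1.
  by rewrite expR_gt0 expR_lt1 /r; lra.
have Q0 : packing_Q f E (h + d) e = 0%E.
  apply: le_anti; rewrite packing_Q_ge0 andbT.
  pose K := (1 - expR (r - (h + d)))^-1.
  have cvg0 : (EFin \o geometric K (expR (r - (h + d)))) @ \oo --> 0%E.
    apply: cvg_EFin; first exact: nearW.
    by apply: cvg_geometric; rewrite ger0_norm ?expR_ge0//; case/andP: q01.
  rewrite -(cvg_lim _ cvg0)//; apply: lee_lim.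
  - exact/ereal_nonincreasing_is_cvgn/packing_QN_nonincreasing.
  - by apply/cvg_ex; exists 0%E.
  - exists (maxn 1 N) => // n /= nN.
    rewrite /geometric/= mulrC; apply: packing_QN_le_geometric => //.
    + by rewrite /r; lra.
    + by apply: leq_trans nN; rewrite leq_max.
    + by move=> l nl; apply: sepl; exact: leq_trans nl.
apply: le_anti; rewrite packing_P_ge0 andbT.
apply: ereal_inf_lbound; exists (fun=> E); first by move=> z Ez; exists 0%N.
by apply: eseries0 => j _ _; exact: Q0.
Qed.

Lemma packing_entropy_le_htop E : (packing_entropy f E <= htop f)%E.
Proof.
rewrite packing_entropyE htopE; apply: ge_ereal_sup => _ [e /= e0 <-].
apply: le_trans (packing_entropy_scale_le E e0) _.
by apply: ereal_sup_ubound; exists (e / 2) => //=; rewrite divr_gt0.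
Qed.

End upper_bound.

(** * Lower bound: residual sets have full packing entropy *)

Section lower_bound.
Context {R : realType} {X : pointedMetricType R}.
Variable f : X -> X.
Hypothesis cf : continuous f.
Variable M : nat -> R -> nat.
Hypothesis spec : nonuniform_specification f M.

(* Points shadowing an [(L, e0)]-separated set after a fixed delay [a] are found
   in any set [F] dense in [U]; since [a] does not depend on [L], these
   [expR (L * h)] points are still exponentially many at the scale [a + L]. *)
Lemma packing_Q_ge1 (U F : set X) e0 e h t : open U -> U !=set0 ->
  U `<=` closure F -> 0 < e -> e <= e0 / 4 -> 0 <= t < h ->
  (h%:E < htop_scale f e0)%E -> (1 <= packing_Q f F t e)%E.
Proof.
move=> oU U0 UF ep ee0 /andP[t0 th] hh.
have e00 : 0 < e0 / 4 by exact: lt_le_trans ee0.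
have [a aP] := specification_shadow spec oU U0 e00.
apply: lime_ge; first exact/ereal_nonincreasing_is_cvgn/packing_QN_nonincreasing.
apply: nearW => N.
(* For [L >= N1] the surplus [(h - t) * L] pays for the delay, that is, [t * (a + L) <= h * L]. *)
pose N1 := Num.bound (t * a%:R / (h - t)).
have [L + hL] := limn_esup_gt_often (maxn N.+1 N1) hh.
rewrite geq_max => /andP[NL N1L].
have L0 : 0 < L%:R :> R by rewrite ltr0n (leq_trans _ NL).
have aL : t * (a + L)%:R <= h * L%:R.
  have : t * a%:R / (h - t) < L%:R.
    rewrite (lt_le_trans (archi_boundP _))// ?ler_nat//.
    by rewrite divr_ge0 ?mulr_ge0// subr_ge0 ltW.
  by rewrite ltr_pdivrMr ?subr_gt0// natrD; lra.
have : ((expR (h * L%:R))%:E < separated_number f L e0)%E.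
  have := separated_number_ge1 f L e0; move: hL.
  case: separated_number => [s| |] //; last by rewrite ltey.
  rewrite lee_fin => + s1; have s0 : 0 < s by lra.
  rewrite lne_EFin// -EFinM !lte_fin mulrC ltr_pdivlMr// => hs.
  by rewrite -[s in _ < s]lnK ?posrE// ltr_expR.
move=> /ereal_sup_gt[_ [A sepA <-]]; rewrite lte_fin => hA.
(* Shadowing is an open condition on [z], so [z] can be moved into [F], which is dense in [U]. *)
have /choice[p pP] : forall w, exists p, F p /\ shadows f (e0 / 4) a L w p.
  move=> w; have [z Uz shz] := aP L w.
  have nz : nbhs z [set z | shadows f (e0 / 4) a L w z].
    by apply: open_nbhs_nbhs; split=> //; exact: open_shadows.
  by have [p [Fp shp]] := UF z Uz _ nz; exists p.
(* Two shadowing errors below [e0 / 4] leave more than [e0 / 2 >= 2 * e] of the separation [e0]. *)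
have far w w' : w \in A -> w' \in A -> w != w' ->
    2 * e < bowen_dist f (a + L) (p w) (p w').
  move=> wA wA' ww'; have e0' : 0 <= e0 by lra.
  have [i iL iw] := bowen_dist_gtP e0' (sepA w w' wA wA' ww').
  have iaL : (a + i < a + L)%N by rewrite ltn_add2l.
  apply: lt_le_trans (mdist_le_bowen f (p w) (p w') iaL).
  have := (pP w).2 i iL; have := (pP w').2 i iL.
  have := metric_triangle (iter i f w) (iter (a + i) f (p w)) (iter i f w').
  have := metric_triangle (iter (a + i) f (p w)) (iter (a + i) f (p w')) (iter i f w').
  rewrite (metric_sym (iter (a + i) f (p w')) (iter i f w')); lra.
pose x k := p (nth point A k).
(* More than [expR (h * L)] balls, each of weight at least [expR (- (h * L))], sum to at least 1. *)
apply: (@le_trans _ _ (\esum_(k in `I_#|` A|) (expR (- (t * (a + L)%:R)))%:E)).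
  rewrite esum_fset//.
  rewrite -fsbig_ord sumEFin sumr_const card_ord lee_fin.
  rewrite -[leRHS]mulr_natl -ler_pdivrMr ?expR_gt0// -expRN opprK mul1r.
  by apply: ltW; apply: le_lt_trans hA; rewrite ler_expR.
apply: ereal_sup_ubound; exists `I_#|` A|, x, (fun=> (a + L)%N); split=> //; split.
  move=> k _; split; first exact: (pP _).1.
  by rewrite (leq_trans (ltnW NL))// leq_addl.
move=> k k' /= kA kA' [y [yk yk']].
(* A common point of two closed balls would put their centres within [2 * e], against [far]. *)
apply/eqP; rewrite -(nth_uniq point kA kA' (fset_uniq A)).
apply/negPn/negP => neq.
have := far _ _ (mem_nth point kA) (mem_nth point kA') neq.
rewrite ltNge bowen_dist_leP//; first lra.
move=> i iL; rewrite (le_trans (metric_triangle _ (iter i f y) _))//.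
have := closure_bowen_ball cf ep yk; have := closure_bowen_ball cf ep yk'.
have := mdist_le_bowen f (x k) y iL; have := mdist_le_bowen f (x k') y iL.
rewrite (metric_sym (iter i f y)) -/(x k) -/(x k'); lra.
Qed.

Hypothesis compactX : compact [set: X].

(** Were every [F j] nowhere dense, the complements of the closures would be open and dense, and
    Baire would give a point of [Z] outside all [F j]. The somewhere dense [F j] alone contributes 1
    to the series. *)
Lemma residual_packing_P_ge1 (O : nat -> set X) (Z : set X) e0 e h t :
  (forall i, open (O i) /\ dense (O i)) -> \bigcap_i O i `<=` Z ->
  0 < e -> e <= e0 / 4 -> 0 <= t < h -> (h%:E < htop_scale f e0)%E ->
  (1 <= packing_P f Z t e)%E.
Proof.
move=> Oi OZ ep ee0 th hh; apply: le_ereal_inf_tmp => _ [F ZF <-].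
have [j [U [oU U0 UF]]] : exists j U, [/\ open U, U !=set0 & U `<=` closure (F j)].
  apply: contrapT => no.
  have Fj j : open (~` closure (F j)) /\ dense (~` closure (F j)).
    split; first exact/closed_openC/closed_closure.
    move=> U U0 oU; apply: contrapT => UF; apply: no; exists j, U; split=> // x Ux.
    by apply: contrapT => nFx; apply: UF; exists x.
  have dOF : dense (\bigcap_i (O i `&` ~` closure (F i))).
    apply: compact_hausdorff_baire compactX (@metric_hausdorff _ _) _ => i.
    split; first exact: openI (Oi i).1 (Fj i).1.
    move=> U U0 oU; have [x Ux] := (Oi i).2 U U0 oU.
    have [|y [[Uy Oy] Fy]] := (Fj i).2 (U `&` O i) _ (openI oU (Oi i).1).
      by exists x.
    by exists y.
  have [|z [_ zOF]] := dOF setT _ openT; first by exists point.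
  have [|j _ Fjz] := ZF z; first by apply: OZ => i _; exact: (zOF i I).1.
  exact: (zOF j I).2 (subset_closure Fjz).
apply: le_trans (packing_Q_ge1 oU U0 UF ep ee0 th hh) _.
rewrite (nneseries_split 0 j.+1)//; last by move=> k _; exact: packing_Q_ge0.
rewrite big_nat_recr//= add0n -addeA addeCA leeDl// adde_ge0//.
  by apply: sume_ge0 => k _; exact: packing_Q_ge0.
by apply: nneseries_ge0 => k _ _; exact: packing_Q_ge0.
Qed.

Lemma residual_packing_entropy_ge (O : nat -> set X) (Z : set X) :
  (forall i, open (O i) /\ dense (O i)) -> \bigcap_i O i `<=` Z ->
  (htop f <= packing_entropy f Z)%E.
Proof.
move=> Oi OZ; rewrite htopE packing_entropyE; apply: ge_ereal_sup => _ [e0 /= e00 <-].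
have e40 : 0 < e0 / 4 by rewrite divr_gt0.
apply: (@le_trans _ _ (packing_entropy_scale f Z (e0 / 4))); last first.
  by apply: ereal_sup_ubound; exists (e0 / 4).
apply: le_ereal_inf_tmp => _ [t [t0 Pt] <-].
rewrite leNgt; apply/negP => tlt.
(* An [h] strictly between [t] and the entropy at scale [e0] forces [packing_P] to be at least 1,
   contradicting [Pt]. *)
have [h th hh] : exists2 h : R, t < h & (h%:E < htop_scale f e0)%E.
  move: tlt; case: htop_scale => [s| |//].
    rewrite lte_fin => ts; exists ((t + s) / 2); rewrite ?lte_fin; lra.
  by move=> _; exists (t + 1); rewrite ?ltey//; lra.
have tth : 0 <= t < h by rewrite t0.
have := residual_packing_P_ge1 Oi OZ e40 (lexx _) tth hh.
by rewrite Pt lee_fin ler10.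
Qed.

End lower_bound.

Theorem theorem5 (R : realType) (X : pointedMetricType R) (f : X -> X)
    (compactX : compact [set: X]) (two_points : exists x y : X, x <> y)
    (continuous_f : continuous f)
    (specification : exists M : nat -> R -> nat, nonuniform_specification f M) :
  (forall K : set (probability (borel X) R),
     K `<=` invariant_measures f ->
     oversaturated f K !=set0 ->
     packing_entropy f (oversaturated f K) = htop f) /\
  packing_entropy f (completely_irregular f) = htop f.
Proof.
have [M spec] := specification.
have [D [Dres Duniv]] := universal_residual compactX continuous_f spec.
(* The upper bound holds for every set, the lower one for every set containing the residual set of
   universal points. *)
have full (Z : set X) : universal f `<=` Z -> packing_entropy f Z = htop f.
  move=> uZ; apply/eqP; rewrite eq_le packing_entropy_le_htop//=.
  apply: (residual_packing_entropy_ge continuous_f spec compactX Dres).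
  exact: subset_trans uZ.
split.
  move=> K _ [x Kx]; apply: full => z uz mu Kmu.
  exact: (universal_limit_measures uz (Kx mu Kmu)).
apply: full => z uz phi [cphi [x irrx]].
exact: universal_irregular uz irrx.
Qed.
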